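(* Let $p>0$, let $A(t)$ be a real $n\times n$ matrix and $f(t)\in\mathbb{R}^n$ a vector, both with continuous entries and satisfying $A(t+p)=A(t)$, $f(t+p)=f(t)$ for all $t\in\mathbb{R}$. Let $X(t)$ be the fundamental solution matrix of the homogeneous system $x'=A(t)x$ with $X(0)=I$, and let $$b=X(p)\int_0^p X^{-1}(s)f(s)\,ds .$$ Assume that the homogeneous system $x'=A(t)x$ has a non-trivial $p$-periodic solution (so that the matrix $I-X(p)$ is singular). Consider the non-homogeneous system $$x'=A(t)x+f(t). \qquad ( * )$$ Case 1. If $b$ does not belong to the range of $I-X(p)$, then all solutions of $( * )$ are unbounded as $t\to\infty$. Case 2. If $b$ belongs to the range of $I-X(p)$, then $( * )$ has infinitely many $p$-periodic solutions. Moreover, in this case: (i) If $\rho(X(p))>1$, then $( * )$ also has unbounded solutions. (ii) If $\rho(X(p))=1$, $\lambda=1$ is the only eigenvalue of $X(p)$ on the unit circle $|\lambda|=1$, and it has as many linearly independent eigenvectors as its multiplicity (i.e., the Jordan block corresponding to $\lambda=1$ is diagonal), then every solution of $( * )$ approaches one of the $p$-periodic solutions of $( * )$ as $t\to\infty$. (iii) If $\rho(X(p))=1$, there are other eigenvalues of $X(p)$ on the unit circle $|\lambda|=1$ in addition to $\lambda=1$, and all eigenvalues of $X(p)$ on the unit circle have diagonal Jordan blocks, then all solutions of $( * )$ are bounded as $t\to\infty$.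
   Context: $\rho(M)=\max_i|\lambda_i|$ denotes the spectral radius of a matrix $M$, the maximum being over all (complex) eigenvalues $\lambda_i$ of $M$. An eigenvalue ''has diagonal Jordan blocks'' if it has as many linearly independent eigenvectors as its algebraic multiplicity. A solution $x(t)$ is bounded (unbounded) as $t\to\infty$ if $\|x(t)\|$ is bounded (unbounded) on $[0,\infty)$. A solution $x(t)$ approaches a solution $y(t)$ as $t\to\infty$ if $\|x(t)-y(t)\|\to 0$. *)

(* Defs.v *)
From mathcomp Require Import all_boot all_order all_algebra.
From mathcomp Require Import complex.
From mathcomp Require Import all_classical all_reals all_analysis.

Set Implicit Arguments.
Unset Strict Implicit.
Unset Printing Implicit Defensive.

Import Order.TTheory GRing.Theory Num.Theory.
Import numFieldNormedType.Exports.

Local Open Scope classical_set_scope.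
Local Open Scope ring_scope.
Local Open Scope complex_scope.

Section Systems.
Context {R : realType} {n : nat}.
Implicit Types (A X : R -> 'M[R]_n) (f x y : R -> 'cV[R]_n) (p : R).

Definition continuous_entries {m q : nat} (F : R -> 'M[R]_(m, q)) : Prop :=
  forall i j, continuous (fun t : R => F t i j).

Definition solution A f x : Prop :=
  forall t : R, is_derive t (1 : R) x (A t *m x t + f t).

Definition homogeneous_solution A x : Prop := solution A (fun=> 0) x.

Definition fundamental_matrix A X : Prop :=
  X 0 = 1%:M /\ forall t : R, is_derive t (1 : R) X (A t *m X t).

Definition vec_integral p (g : R -> 'cV[R]_n) : 'cV[R]_n :=
  \col_i Rintegral lebesgue_measure `[0, p] (fun s => g s i 0).

Definition b_vector X f p : 'cV[R]_n :=
  X p *m vec_integral p (fun s => invmx (X s) *m f s).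

Definition in_range (M : 'M[R]_n) (v : 'cV[R]_n) : Prop :=
  exists c : 'cV[R]_n, v = M *m c.

(* The norm is the sup norm of the library; all norms on R^n are equivalent. *)
Definition bounded_sol x : Prop :=
  exists K : R, forall t : R, 0 <= t -> `|x t| <= K.

Definition approaches x y : Prop :=
  `|x t - y t| @[t --> +oo] --> (0 : R).

End Systems.

Section Spectrum.
Context {R : realType} {n : nat}.
Implicit Types (M : 'M[R]_n) (l : R[i]).

Definition complexify M : 'M[R[i]]_n := map_mx (real_complex R) M.

(* [eigenvalue] and [eigenspace] refer to row vectors v with v *m M = l *: v;
   the transpose turns this into the usual column eigenvectors. *)
Definition is_eigenvalue M l : bool := eigenvalue (complexify M)^T l.

Definition geometric_multiplicity M l : nat :=
  \rank (eigenspace (complexify M)^T l).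

Definition algebraic_multiplicity M l : nat :=
  mup l (char_poly (complexify M)).

Definition diagonal_jordan_blocks M l : Prop :=
  geometric_multiplicity M l = algebraic_multiplicity M l.

(* All complex eigenvalues, listed with algebraic multiplicity. *)
Definition eigenvalues M : seq R[i] :=
  sval (closed_field_poly_normal (char_poly (complexify M))).

Definition spectral_radius M : R :=
  \big[Num.max/0]_(l <- eigenvalues M) ComplexField.Normc.normc l.

Lemma mem_eigenvalues M l : (l \in eigenvalues M) = is_eigenvalue M l.
Proof.
have -> : is_eigenvalue M l = root (char_poly (complexify M)) l.
  rewrite /is_eigenvalue eigenvalue_root_char /char_poly -det_tr.
  by rewrite /char_poly_mx linearB /= tr_scalar_mx map_trmx trmxK.
rewrite /eigenvalues.
case: closed_field_poly_normal => r /= Dr.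
by rewrite Dr (monicP (char_poly_monic _)) scale1r root_prod_XsubC.
Qed.

End Spectrum.

(* Main.v *)
Require Import Defs.
From mathcomp Require Import all_boot all_order all_algebra.
From mathcomp Require Import perm complex ring lra.
From mathcomp Require Import all_classical all_reals all_analysis.

(** Everything is read off from the monodromy matrix [M := X p].  Because [A] is
    periodic, [X (t + p) = X t M] ([fundamental_shift]), so a solution [x]
    sampled at the multiples of [p] follows the affine recursion
    [x((k+1) p) = M x(k p) + b] ([solution_next_period]), and two solutions
    differ by a flow [X t c], whose size at time [t] is that of [M^k c] with [k]
    the number of periods elapsed, up to the bounded factor [X s], [0 <= s <= p]
    ([flow_norm_le]).

    If [b] is not in the range of [1 - M], some row vector [u] has [u M = u] and
    [u b != 0]; then [u x(k p)] is an arithmetic progression with nonzero step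
    and [x] is unbounded ([resonance_unbounded]).  If [b = (1 - M) c], the
    solution starting at [c] returns to [c] after one period, hence is periodic,
    and adding multiples of a periodic homogeneous solution gives infinitely
    many.  The remaining claims concern the powers of [M] only:
    - bounded orbits of [M] force the spectral radius to be at most 1
      ([spectral_radius_le1]);
    - if the spectral radius is at most 1 and the unit eigenvalues have diagonal
      Jordan blocks, each complex vector is a sum of eigenvectors for unit
      eigenvalues plus a vector whose orbit decays geometrically
      ([spectral_circle_splitting]).  Hence orbits are bounded, and when 1 is
      the only unit eigenvalue they converge to a fixed vector of [M], which is
      the initial perturbation leading to the limiting periodic solution.

    The splitting is obtained without Jordan forms: equality of the two
    multiplicities gives [ker (M - l)^2 = ker (M - l)] by a rank normal form and
    a block determinant ([diagonal_block_ker_sqr]), and the factors of the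
    characteristic polynomial are then peeled off one at a time
    ([annihilated_circle_splitting]).

    The theory of linear systems used here is uniqueness (an energy estimate),
    invertibility of [X], and the variation of constants formula, which rests on
    a primitive defined on the whole line. *)

Set Implicit Arguments.
Unset Strict Implicit.
Unset Printing Implicit Defensive.

Import Order.TTheory GRing.Theory Num.Theory.
Import numFieldNormedType.Exports.

Local Open Scope classical_set_scope.
Local Open Scope ring_scope.
Local Open Scope complex_scope.

(** * Diagonal Jordan blocks and decaying orbits *)

Lemma char_poly_similar (F : fieldType) n (L M N : 'M[F]_n) :
  L \in unitmx -> M *m L = L *m N -> char_poly M = char_poly N.
Proof.
move=> Lu ML; set L' := map_mx polyC L.
have detL : \det L' != 0.
  by rewrite det_map_mx polyC_eq0 -unitfE -unitmxE.
apply: (mulIf detL); rewrite mulrC [RHS]mulrC [LHS]mulrC -!det_mulmx.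
congr (\det _); rewrite /char_poly_mx mulmxBl mulmxBr -!map_mxM ML.
by rewrite mul_scalar_mx mul_mx_scalar.
Qed.

(** With [r] the rank of [M - l], conjugating by [L] turns [M - l] into the
    block matrix with rows [W11 W12] and [0 0], where [W := U L].  Hence the
    characteristic polynomial of [M] is that of [l + W11] times [('X - l)^s],
    and the algebraic multiplicity of [l] is exactly [s] iff [W11] is
    invertible, iff applying [M - l] twice kills nothing more than applying it
    once. *)
Lemma ker_sqr_normal_form (F : fieldType) n r s (e : (n = r + s)%N)
    (M L U : 'M[F]_n) (l : F) (v : 'cV[F]_n) :
  L \in unitmx -> U \in unitmx -> M - l%:M = L *m pid_mx r *m U ->
  mup l (char_poly M) = s ->
  (M - l%:M) *m ((M - l%:M) *m v) = 0 -> (M - l%:M) *m v = 0.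
Proof.
subst n => Lu Uu; rewrite pid_mx_block => ME mupE.
pose W := U *m L.
have EL : M *m L = L *m (l%:M + block_mx 1%:M 0 0 0 *m W).
  rewrite mulmxDr /W !mulmxA -ME mulmxBl mul_scalar_mx mul_mx_scalar.
  by rewrite addrC subrK.
rewrite (char_poly_similar Lu EL) in mupE.
rewrite -[W]submxK mulmx_block !mul1mx !mul0mx !addr0 in mupE.
rewrite [l%:M]scalar_mx_block add_block_mx !addr0 !add0r in mupE.
set W11 := ulsubmx W in mupE; set W12 := ursubmx W in mupE.
have : char_poly (block_mx (l%:M + W11) W12 0 (l%:M : 'M[F]_s)) =
   char_poly (l%:M + W11) * ('X - l%:P) ^+ s.
  rewrite /char_poly /char_poly_mx map_block_mx scalar_mx_block opp_block_mx.
  rewrite map_mx0 oppr0 add_block_mx ?addr0 ?add0r; rewrite det_ublock; congr (_ * _).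
  by rewrite map_scalar_mx -raddfB/= det_scalar.
move=> cE; rewrite {}cE mupM ?expf_neq0 ?polyXsubC_eq0 ?monic_neq0 ?char_poly_monic // in mupE.
rewrite mup_XsubCX eqxx in mupE.
have m0 : mup l (char_poly (l%:M + W11)) = 0%N.
  by move/eqP: mupE; rewrite -{2}[s]add0n eqn_add2r => /eqP.
have W11u : W11 \in unitmx.
  rewrite -row_free_unit -kermx_eq0; apply: contraT => k0.
  suff: root (char_poly (l%:M + W11)) l.
    by rewrite -dvdp_XsubCl XsubC_dvd ?monic_neq0 ?char_poly_monic // m0.
  by rewrite -eigenvalue_root_char /eigenvalue /eigenspace addrC addKr.
rewrite {}ME -!mulmxA => H.
have {}H : block_mx 1%:M 0 0 0 *m (W *m (block_mx 1%:M 0 0 0 *m (U *m v)))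
    = 0 :> 'cV[F]_(r + s).
  by rewrite -[LHS](mulKmx Lu) /W -[U *m L *m _]mulmxA H mulmx0.
suff -> : block_mx 1%:M 0 0 0 *m (U *m v) = 0 :> 'cV_(r + s) by rewrite mulmx0.
move: H; rewrite -[W]submxK -/W11 -[U *m v]vsubmxK.
rewrite !mul_block_col !mul1mx !mul0mx !addr0 mulmx0 addr0.
move/(congr1 usubmx); rewrite col_mxKu linear0.
move/(congr1 (mulmx (invmx W11) : 'cV_r -> 'cV_r)).
by rewrite mulKmx // mulmx0 => ->; rewrite col_mx0.
Qed.

(** Gaussian elimination provides the normal form, with [r] the rank of
    [M - l]; transposition does not change the rank, so [n - r] is also the
    dimension of the row-vector eigenspace of [M^T]. *)
Lemma diagonal_block_ker_sqr (F : fieldType) n (M : 'M[F]_n) (l : F)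
    (v : 'cV[F]_n) :
  \rank (eigenspace M^T l) = mup l (char_poly M) ->
  (M - l%:M) *m ((M - l%:M) *m v) = 0 -> (M - l%:M) *m v = 0.
Proof.
set N := M - l%:M => rkE.
have rN : (\rank N <= n)%N by exact: rank_leq_row.
apply: (@ker_sqr_normal_form F n (\rank N) (n - \rank N)%N
  _ M (col_ebase N) (row_ebase N)).
- by rewrite subnKC.
- exact: col_ebase_unit.
- exact: row_ebase_unit.
- by rewrite mulmx_ebase.
- rewrite -rkE /eigenspace mxrank_ker; congr (_ - _)%N.
  by rewrite -[l%:M]tr_scalar_mx -linearB /= mxrank_tr.
Qed.


Lemma horner_mx_eigenvector (F : fieldType) n (M : 'M[F]_n.+1) (q : {poly F})
    (l : F) (z : 'cV[F]_n.+1) :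
  M *m z = l *: z -> horner_mx M q *m z = q.[l] *: z.
Proof.
move=> Mz; elim/poly_ind: q => [|q c IH].
  by rewrite rmorph0 mul0mx horner0 scale0r.
rewrite rmorphD rmorphM /= horner_mx_X horner_mx_C mulmxDl -mulmxA Mz.
rewrite -scalemxAr IH mul_scalar_mx hornerD hornerM hornerX hornerC.
by rewrite scalerDl scalerA mulrC.
Qed.

Section Decay.
Context {R : realType}.
Local Notation C := R[i].
Local Notation normc := ComplexField.Normc.normc.

(** Geometric decay rather than convergence to 0: the explicit rate makes
    [decays_shift] an induction on the exponent, with no limit argument. *)
Definition decays n (M : 'M[C]_n) (v : 'cV[C]_n) : Prop :=
  exists K r : R, [/\ 0 <= K, 0 <= r < 1 &
    forall k i, normc ((M ^+ k *m v) i 0) <= K * r ^+ k].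

(** Eigenvalues may repeat in [es] and its vectors may vanish, so that terms
    never have to be merged or discarded. *)
Definition circle_splitting n (M : 'M[C]_n) (s : seq C) (v : 'cV[C]_n) : Prop :=
  exists (es : seq (C * 'cV[C]_n)) (b : 'cV[C]_n),
    [/\ forall e, e \in es ->
          [/\ e.1 \in s, normc e.1 = 1 & M *m e.2 = e.1 *: e.2],
        v = \sum_(e <- es) e.2 + b & decays M b].

Lemma normc_ge0 (z : C) : 0 <= normc z.
Proof. by case: z => a b; rewrite sqrtr_ge0. Qed.

Lemma expmxS n (M : 'M[C]_n) (v : 'cV[C]_n) k :
  M ^+ k.+1 *m v = M *m (M ^+ k *m v).
Proof. by rewrite exprS mulmxA. Qed.

Lemma expmxSr n (M : 'M[C]_n) (v : 'cV[C]_n) k :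
  M ^+ k.+1 *m v = M ^+ k *m (M *m v).
Proof. by rewrite exprSr mulmxA. Qed.

Lemma decays0 n (M : 'M[C]_n) : decays M 0.
Proof.
exists 0, 0; split => // [|k i]; first by rewrite lexx ltr01.
by rewrite mulmx0 mxE ComplexField.Normc.normc0 mul0r.
Qed.

(** The orbit [v_k] of [v] satisfies [v_(k+1) = l v_k + w_k], where [w_k] is
    the orbit of [(M - l) v]: a contraction driven by a decaying forcing.  Any
    rate [q < 1] with [q >= r] and [q > |l|] is preserved by this recursion. *)
Lemma decays_shift n (M : 'M[C]_n) (l : C) (v : 'cV[C]_n) :
  normc l < 1 -> decays M ((M - l%:M) *m v) -> decays M v.
Proof.
move=> l1 [K [r [K0 /andP[r0 r1] Kr]]].
have l0 := normc_ge0 l.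
(* [1 - q] is at most half of both [1 - a] and [1 - r]; the larger of [a] and
   [r] would not do, since [q - a] is a denominator below. *)
pose a := normc l; pose q := 1 - (1 - a) * (1 - r) / 2.
have aq : a < q by rewrite /q /a; nra.
have rq : r <= q by rewrite /q /a; nra.
have q1 : q < 1 by rewrite /q /a; nra.
pose S := \sum_i normc (v i 0).
have S0 : 0 <= S by apply: sumr_ge0 => i _; exact: normc_ge0.
have D0 : 0 <= K / (q - a) by rewrite divr_ge0 // subr_ge0 ltW.
exists (S + K / (q - a)), q; split; first exact: addr_ge0.
  by rewrite q1 (le_trans r0 rq).
elim=> [|k IH] i.
  rewrite !expr0 mulr1 mul1mx (@le_trans _ _ S) ?lerDl //.
  rewrite /S (bigD1 i) //= lerDl; apply: sumr_ge0 => j _; exact: normc_ge0.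
have -> : M ^+ k.+1 *m v = l *: (M ^+ k *m v) + M ^+ k *m ((M - l%:M) *m v).
  rewrite mulmxBl mulmxBr -expmxSr mul_scalar_mx -scalemxAr.
  by rewrite addrC subrK.
move: (IH i) (Kr k i); set x := M ^+ k *m v; set y := M ^+ k *m _ => IHi Kri.
have -> : (l *: x + y) i 0 = l * x i 0 + y i 0 by rewrite !mxE.
apply: le_trans (le_normcD _ _) _.
rewrite ComplexField.Normc.normcM -/a.
apply: (@le_trans _ _ (a * ((S + K / (q - a)) * q ^+ k) + K * q ^+ k)).
  apply: lerD; first by rewrite ler_wpM2l ?normc_ge0.
  apply: le_trans Kri _; rewrite ler_wpM2l //.
  by rewrite lerXn2r // nnegrE // (le_trans r0).
have -> : K = K / (q - a) * (q - a) by rewrite divfK // subr_eq0 gt_eqF.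
rewrite mulfK ?subr_eq0 ?gt_eqF //.
rewrite exprS; set D := K / _ in D0 *.
have qk : 0 <= q ^+ k by rewrite exprn_ge0 // (le_trans r0).
rewrite [X in X <= _](_ : _ = (a * S + D * q) * q ^+ k); last by ring.
rewrite mulrA ler_wpM2r // mulrDl lerD2r mulrC ler_wpM2l // ltW //.
Qed.

(** Induction on the list of roots, peeling off one factor ['X - l] at a
    time.
    - If [|l| < 1], the splitting of [(M - l) v] lifts to [v]: divide each unit
      eigenvector by [e.1 - l], which is nonzero, and what is left decays by
      [decays_shift].
    - If [|l| = 1] and [l] occurs again, the hypothesis on kernels removes the
      repeated factor.
    - If [|l| = 1] and [l] is not a root of the remaining product [q], then
      [q(M) v / q(l)] is the [l]-eigencomponent of [v], and the rest is
      annihilated by [q(M)].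
    This replaces the Jordan normal form. *)
Lemma annihilated_circle_splitting n (M : 'M[C]_n.+1) (s : seq C) (v : 'cV[C]_n.+1) :
  (forall l, l \in s -> normc l <= 1) ->
  (forall l u, l \in s -> normc l = 1 ->
     (M - l%:M) *m ((M - l%:M) *m u) = 0 -> (M - l%:M) *m u = 0 :> 'cV_n.+1) ->
  horner_mx M (\prod_(l <- s) ('X - l%:P)) *m v = 0 ->
  circle_splitting M s v.
Proof.
have hX l : horner_mx M ('X - l%:P) = M - l%:M.
  by rewrite rmorphB /= horner_mx_X horner_mx_C.
elim: s v => [|l s IH] v s1 ss kv.
  exists [::], 0; split => //; last exact: decays0.
  by move: kv; rewrite big_nil rmorph1 mul1mx big_nil addr0.
have s1' m : m \in s -> normc m <= 1 by move=> ms; rewrite s1 // inE ms orbT.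
have ss' m u : m \in s -> normc m = 1 -> (M - m%:M) *m ((M - m%:M) *m u) = 0 ->
    (M - m%:M) *m u = 0 :> 'cV_n.+1.
  by move=> ms; apply: ss; rewrite inE ms orbT.
have up (es : seq (C * 'cV[C]_n.+1)) : (forall e, e \in es ->
          [/\ e.1 \in s, normc e.1 = 1 & M *m e.2 = e.1 *: e.2]) ->
   (forall e, e \in es ->
          [/\ e.1 \in l :: s, normc e.1 = 1 & M *m e.2 = e.1 *: e.2]).
  by move=> H e /H[es1 ? ?]; split=> //; rewrite inE es1 orbT.
have := s1 l; rewrite mem_head le_eqVlt => /(_ isT)/orP[/eqP l1|l1]; last first.
  move: kv; rewrite big_cons mulrC rmorphM /= hX -mulmxA => kv.
  have [es [b [esP vE db]]] := IH _ s1' ss' kv.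
  pose a := \sum_(e <- es) (e.1 - l)^-1 *: e.2.
  have Ma : (M - l%:M) *m a = \sum_(e <- es) e.2.
    rewrite mulmx_sumr; apply: eq_big_seq => e /esP[_ e1 Me].
    rewrite -scalemxAr mulmxBl Me mul_scalar_mx -scalerBl scalerA mulVf ?scale1r //.
    by rewrite subr_eq0; apply: contraTneq l1 => <-; rewrite e1 ltxx.
  exists [seq (e.1, (e.1 - l)^-1 *: e.2) | e <- es], (v - a); split.
  - move=> _ /mapP[e /(up _ esP)[e1 e2 Me] ->]; split=> //=.
    by rewrite -scalemxAr Me scalerA mulrC -scalerA.
  - by rewrite big_map /= -/a addrC subrK.
  - apply: (decays_shift l1); rewrite mulmxBr Ma vE addrC addKr.
    exact: db.
have [ls|ls] := boolP (l \in s).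
  have [es [b [esP vE db]]] : circle_splitting M s v.
    apply: IH => //.
    move: kv; rewrite big_cons !(perm_big _ (perm_to_rem ls)) !big_cons /=.
    rewrite !rmorphM /= hX -!mulmxA; apply: ss => //; exact: mem_head.
  by exists es, b; split=> //; exact: up.
move: kv; rewrite big_cons; set q := \prod_(_ <- _) _ => kv.
have ql : q.[l] != 0 by rewrite -[_ == 0]/(root q l) root_prod_XsubC.
pose a := q.[l]^-1 *: (horner_mx M q *m v).
have Ma : M *m a = l *: a.
  move: kv; rewrite rmorphM /= hX -mulmxA mulmxBl mul_scalar_mx.
  move/eqP; rewrite subr_eq0 => /eqP E.
  by rewrite -scalemxAr E !scalerA mulrC.
have [es [b [esP vE db]]] : circle_splitting M s (v - a).
  apply: IH => //.
  by rewrite mulmxBr (horner_mx_eigenvector q Ma) scalerA divff // scale1r subrr.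
exists ((l, a) :: es), b; split=> //.
- move=> e; rewrite inE => /orP[/eqP-> /=|/(up _ esP)//].
  by split=> //; exact: mem_head.
- by rewrite big_cons /= -addrA -vE addrC subrK.
Qed.

End Decay.

(** * Orbits of a real matrix *)

Section RealOrbits.
Context {R : realType}.
Local Notation C := R[i].
Local Notation normc := ComplexField.Normc.normc.
Implicit Types (l z : C).

Lemma normc_normr l : `|l| = (normc l)%:C.
Proof. by case: l. Qed.

Lemma normc_eq1 l : normc l = 1 -> `|l| = 1.
Proof. by rewrite normc_normr => ->. Qed.

Lemma normr_Re_le z : `|complex.Re z| <= normc z.
Proof.
case: z => a b /=; rewrite -sqrtr_sqr ler_wsqrtr // lerDl; exact: sqr_ge0.
Qed.

Lemma normc_le_ReIm z : normc z <= `|complex.Re z| + `|complex.Im z|.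
Proof.
case: z => a b /=; have ab0 : 0 <= `|a| + `|b| by rewrite addr_ge0.
rewrite -[leRHS](ger0_norm ab0) -[leRHS]sqrtr_sqr ler_wsqrtr //.
rewrite sqrrD !real_normK ?num_real // lerD2r lerDl.
by rewrite mulrn_wge0 // mulr_ge0.
Qed.

Lemma normcX l k : normc (l ^+ k) = normc l ^+ k.
Proof.
elim: k => [|k IH]; first by rewrite !expr0 ComplexField.Normc.normc1.
by rewrite !exprS ComplexField.Normc.normcM IH.
Qed.

Variable n : nat.
Implicit Types (M : 'M[R]_n) (c : 'cV[R]_n) (w : 'cV[C]_n).

Definition Re_mx w : 'cV[R]_n := map_mx (@complex.Re R) w.
Definition Im_mx w : 'cV[R]_n := map_mx (@complex.Im R) w.

Lemma Re_mx_mulmx M w : Re_mx (complexify M *m w) = M *m Re_mx w.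
Proof.
apply/matrixP => i j; rewrite !mxE raddf_sum; apply: eq_bigr => k _ /=.
by rewrite !mxE; case: (w k j) => a b /=; rewrite mul0r subr0.
Qed.

Lemma Im_mx_mulmx M w : Im_mx (complexify M *m w) = M *m Im_mx w.
Proof.
apply/matrixP => i j; rewrite !mxE raddf_sum; apply: eq_bigr => k _ /=.
by rewrite !mxE; case: (w k j) => a b /=; rewrite mul0r addr0.
Qed.

Lemma Re_mx_expmx M w k : Re_mx (complexify M ^+ k *m w) = M ^+ k *m Re_mx w.
Proof.
elim: k => [|k IH]; first by rewrite !expr0 !mul1mx.
by rewrite !exprS -!mulmxA Re_mx_mulmx IH.
Qed.

Lemma Im_mx_expmx M w k : Im_mx (complexify M ^+ k *m w) = M ^+ k *m Im_mx w.
Proof.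
elim: k => [|k IH]; first by rewrite !expr0 !mul1mx.
by rewrite !exprS -!mulmxA Im_mx_mulmx IH.
Qed.

Lemma Re_mxE w i : Re_mx w i 0 = complex.Re (w i 0).
Proof. by rewrite mxE. Qed.

Lemma Im_mxE w i : Im_mx w i 0 = complex.Im (w i 0).
Proof. by rewrite mxE. Qed.

Lemma Re_mx_complexify c : Re_mx (map_mx (real_complex R) c) = c.
Proof. by apply/matrixP => i j; rewrite !mxE. Qed.

Lemma is_eigenvalue_vector M l : is_eigenvalue M l ->
  exists2 w : 'cV[C]_n, w != 0 & complexify M *m w = l *: w.
Proof.
move=> /eigenvalueP[v vM v0]; exists v^T.
  by apply: contra v0 => /eqP/(congr1 trmx); rewrite trmxK trmx0 => ->.
by rewrite -[complexify M]trmxK -trmx_mul vM linearZ.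
Qed.

Lemma eigenvector_orbit (M : 'M[C]_n) l w k :
  M *m w = l *: w -> M ^+ k *m w = l ^+ k *: w.
Proof.
move=> Mw; elim: k => [|k IH]; first by rewrite !expr0 mul1mx scale1r.
by rewrite expmxS IH -scalemxAr Mw scalerA exprSr.
Qed.

Lemma normc_le_spectral_radius M l :
  is_eigenvalue M l -> normc l <= spectral_radius M.
Proof.
rewrite -(mem_eigenvalues M) => lM.
exact: (@le_bigmax_seq _ _ _ _ _ l xpredT).
Qed.

Lemma Bernoulli_le (a : R) k : 1 <= a -> 1 + (a - 1) *+ k <= a ^+ k.
Proof.
move=> a1; elim: k => [|k IH]; first by rewrite expr0 mulr0n addr0.
rewrite exprS mulrSr; apply: le_trans (_ : a * (1 + (a - 1) *+ k) <= _).
  have : 0 <= (a - 1) *+ k by rewrite mulrn_wge0 // subr_ge0.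
  by set b := _ *+ _ => b0; nra.
by rewrite ler_wpM2l // (le_trans ler01).
Qed.

(** An eigenvector [w] for [l] has orbit [l^k w]; its real and imaginary parts
    are orbits of the real matrix [M], so boundedness of all real orbits forces
    [|l|^k] to stay bounded. *)
Lemma spectral_radius_le1 M :
  (forall c, exists K : R, forall k i, `|(M ^+ k *m c) i 0| <= K) ->
  spectral_radius M <= 1.
Proof.
move=> bd; rewrite /spectral_radius big_seq.
elim/big_ind: _ => [|x y x1 y1|l]; first exact: ler01.
  by rewrite ge_max x1.
rewrite mem_eigenvalues => /is_eigenvalue_vector[w w0 Mw].
have [i wi0] : exists i, w i 0 != 0.
  apply/existsP; apply: contraT; rewrite negb_exists => /forallP H.
  case/eqP: w0; apply/colP => i; rewrite mxE; apply/eqP.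
  by move: (H i); rewrite negbK.
have [K1 HK1] := bd (Re_mx w); have [K2 HK2] := bd (Im_mx w).
rewrite leNgt; apply/negP => l1.
have q0 : 0 < normc (w i 0).
  rewrite lt_neqAle normc_ge0 andbT eq_sym; apply: contra wi0 => /eqP.
  by move/ComplexField.Normc.eq0_normc => ->.
have bnd k : (normc l - 1) *+ k * normc (w i 0) <= K1 + K2.
  apply: (@le_trans _ _ (normc l ^+ k * normc (w i 0))).
    rewrite ler_wpM2r ?normc_ge0 //.
    by apply: le_trans (Bernoulli_le k (ltW l1)); rewrite lerDr.
  rewrite -normcX -ComplexField.Normc.normcM.
  have -> : l ^+ k * w i 0 = (complexify M ^+ k *m w) i 0.
    by rewrite (eigenvector_orbit _ Mw) mxE.
  apply: le_trans (normc_le_ReIm _) _; apply: lerD.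
    by apply: le_trans (HK1 k i); rewrite -Re_mx_expmx Re_mxE.
  by apply: le_trans (HK2 k i); rewrite -Im_mx_expmx Im_mxE.
have d0 : 0 < (normc l - 1) * normc (w i 0) by rewrite mulr_gt0 // subr_gt0.
pose k := Num.bound ((K1 + K2) / ((normc l - 1) * normc (w i 0))).
have K0 : 0 <= K1 + K2 by apply: le_trans (bnd 0%N); rewrite mulr0n mul0r.
have := bnd k; rewrite mulrnAl -mulr_natr mulrC -ler_pdivlMr // leNgt.
by move=> /negP; apply; apply: archi_boundP; rewrite divr_ge0 // ltW.
Qed.

End RealOrbits.

Section LongTime.
Context {R : realType}.
Local Notation C := R[i].
Local Notation normc := ComplexField.Normc.normc.
Variable n : nat.
Implicit Types (l : C) (M : 'M[R]_n) (c : 'cV[R]_n) (w : 'cV[C]_n).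

(** By Cayley-Hamilton, every vector is annihilated by the product of the
    [M - l] over all eigenvalues, listed with multiplicity. *)
Lemma spectral_circle_splitting M w :
  spectral_radius M <= 1 ->
  (forall l, is_eigenvalue M l -> `|l| = 1 -> diagonal_jordan_blocks M l) ->
  circle_splitting (complexify M) (eigenvalues M) w.
Proof.
case: n M w => [|m] M w rho1 dj.
  exists [::], 0; split=> //; last exact: decays0.
  by rewrite big_nil addr0; apply/colP => -[].
apply: annihilated_circle_splitting => [l|l u|].
- rewrite mem_eigenvalues => lM.
  exact: le_trans (normc_le_spectral_radius lM) rho1.
- rewrite mem_eigenvalues => lM l1; apply: diagonal_block_ker_sqr.
  exact: dj (normc_eq1 l1).
- suff -> : \prod_(l <- eigenvalues M) ('X - l%:P) =
      char_poly (complexify M) by rewrite Cayley_Hamilton mul0mx.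
  rewrite /eigenvalues; case: closed_field_poly_normal => r /= ->.
  by rewrite (monicP (char_poly_monic _)) scale1r.
Qed.

Lemma orbits_bounded M :
  spectral_radius M <= 1 ->
  (forall l, is_eigenvalue M l -> `|l| = 1 -> diagonal_jordan_blocks M l) ->
  forall c, exists K : R, forall k i, `|(M ^+ k *m c) i 0| <= K.
Proof.
move=> rho1 dj c.
have [es [b [esP wE [K [r [K0 /andP[r0 r1] Kr]]]]]] :=
  spectral_circle_splitting (map_mx (real_complex R) c) rho1 dj.
pose S := \sum_(e <- es) \sum_i normc (e.2 i 0).
exists (S + K) => k i.
rewrite -[c]Re_mx_complexify -Re_mx_expmx Re_mxE.
apply: le_trans (normr_Re_le _) _; rewrite wE mulmxDr mxE.
apply: le_trans (le_normcD _ _) _; apply: lerD; last first.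
  by apply: le_trans (Kr k i) _; rewrite ler_piMr // exprn_ile1 // ltW.
have -> : complexify M ^+ k *m (\sum_(e <- es) e.2) =
  \sum_(e <- es) e.1 ^+ k *: e.2.
  rewrite mulmx_sumr; apply: eq_big_seq => e /esP[_ _ Me].
  exact: eigenvector_orbit.
rewrite /S summxE !big_seq.
elim/big_ind2: _ => [|x1 x2 y1 y2 H1 H2|e /esP[_ e1 _]].
- by rewrite ComplexField.Normc.normc0.
- by apply: le_trans (le_normcD _ _) _; exact: lerD.
- rewrite mxE ComplexField.Normc.normcM normcX e1 expr1n mul1r.
  rewrite (bigD1 i) //= lerDl; apply: sumr_ge0 => j _; exact: normc_ge0.
Qed.

(** When 1 is the only unit eigenvalue, the non-decaying part of the splitting
    is fixed by [M]; its real part is the limit [d]. *)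
Lemma orbits_converge M :
  spectral_radius M <= 1 ->
  (forall l, is_eigenvalue M l -> `|l| = 1 -> l = 1) ->
  diagonal_jordan_blocks M 1 ->
  forall c, exists d : 'cV[R]_n, M *m d = d /\
    exists K r : R, [/\ 0 <= K, 0 <= r < 1 &
      forall k i, `|(M ^+ k *m (c - d)) i 0| <= K * r ^+ k].
Proof.
move=> rho1 only1 dj c.
have dj' l : is_eigenvalue M l -> `|l| = 1 -> diagonal_jordan_blocks M l.
  by move=> lM l1; rewrite (only1 l).
have [es [b [esP wE [K [r [K0 r01 Kr]]]]]] :=
  spectral_circle_splitting (map_mx (real_complex R) c) rho1 dj'.
set a := \sum_(e <- es) e.2 in wE.
exists (Re_mx a); split.
  rewrite -Re_mx_mulmx; congr Re_mx; rewrite mulmx_sumr.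
  apply: eq_big_seq => e /esP[]; rewrite mem_eigenvalues => eM e1 ->.
  by rewrite (only1 _ eM (normc_eq1 e1)) scale1r.
exists K, r; split=> // k i.
have -> : c - Re_mx a = Re_mx b.
  by rewrite -[c]Re_mx_complexify wE /Re_mx map_mxD addrC addKr.
by rewrite -Re_mx_expmx Re_mxE; apply: le_trans (normr_Re_le _) _; exact: Kr.
Qed.

End LongTime.

(** * Calculus for matrix-valued functions *)

Section Calculus.
Context {R : realType}.
Implicit Types (t a b C : R).

Lemma is_derive_mxP m n (F : R -> 'M[R]_(m, n)) t D :
  is_derive t (1 : R) F D <->
  forall i j, is_derive t (1 : R) (fun s => F s i j : R) (D i j).
Proof.
split=> [[dF FD] i j|H].
  apply: DeriveDef; first exact: (derivable_mxP F t 1).1.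
  by rewrite -FD derive_mx // mxE.
have dF : derivable F t (1 : R).
  by apply/derivable_mxP => i j; case: (H i j).
apply: DeriveDef => //; rewrite derive_mx //; apply/matrixP => i j.
by rewrite mxE; case: (H i j).
Qed.

Lemma is_derive_sumf n (h : 'I_n -> R -> R) (d : 'I_n -> R) t :
  (forall i, is_derive t (1 : R) (h i) (d i)) ->
  is_derive t (1 : R) (fun s => \sum_i h i s) (\sum_i d i).
Proof.
move=> H.
have -> : (fun s => \sum_i h i s) = \sum_i h i.
  by apply/funext => s; rewrite fct_sumE.
exact: is_derive_sum.
Qed.

Lemma is_derive_mulmx m n q (F : R -> 'M[R]_(m, n)) (G : R -> 'M[R]_(n, q))
    t dF dG :
  is_derive t (1 : R) F dF -> is_derive t (1 : R) G dG ->
  is_derive t (1 : R) (fun s => F s *m G s) (dF *m G t + F t *m dG).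
Proof.
move=> /is_derive_mxP HF /is_derive_mxP HG; apply/is_derive_mxP => i j.
have -> : (fun s => (F s *m G s) i j) = fun s => \sum_k F s i k * G s k j.
  by apply/funext => s; rewrite mxE.
rewrite !mxE -big_split /=; apply: is_derive_sumf => k.
have := is_deriveM (HF i k) (HG k j) => H; apply: (is_derive_eq H).
by rewrite addrC /GRing.scale /= [G t k j * _]mulrC.
Qed.

Lemma is_derive_continuous (h : R -> R) (dh : R -> R) :
  (forall t, is_derive t (1 : R) h (dh t)) -> continuous h.
Proof.
move=> H t; apply/differentiable_continuous; rewrite -derivable1_diffP.
by case: (H t).
Qed.

Lemma MVT_everywhere (h dh : R -> R) a b : a <= b ->
  (forall t, is_derive t (1 : R) h (dh t)) ->
  exists2 c, a <= c <= b & h b - h a = dh c * (b - a).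
Proof.
move=> ab H.
have ch : {within `[a, b], continuous h}.
  exact/continuous_subspaceT/(is_derive_continuous H).
have [c cab ->] := MVT_segment ab (fun x _ => H x) ch.
by exists c => //; move: cab; rewrite in_itv.
Qed.

(** Gronwall in both directions of time: [E exp(- C t)] is nonincreasing and
    [E exp(C t)] is nondecreasing on the interval. *)
Lemma differential_inequality_vanish (E dE : R -> R) a b C : a <= b ->
  (forall t, is_derive t (1 : R) E (dE t)) -> (forall t, 0 <= E t) ->
  (forall t, a <= t <= b -> `|dE t| <= C * E t) ->
  (E a = 0 -> E b = 0) /\ (E b = 0 -> E a = 0).
Proof.
move=> ab HE E0 HC.
have dg k t : is_derive t (1 : R) (fun s => E s * expR (k * s))
    ((dE t + k * E t) * expR (k * t)).
  have He : is_derive t (1 : R) (expR \o *%R k) (expR (k * t) * k).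
    apply: is_derive1_comp.
    have := is_deriveZ k (is_derive_id t (1 : R)) => H.
    by apply: (is_derive_eq H); rewrite /GRing.scale /= mulr1.
  have := is_deriveM (HE t) He => H; apply: (is_derive_eq H).
  by rewrite /GRing.scale /=; ring.
split=> Ez.
- have [c cab] := MVT_everywhere ab (dg (- C)).
  rewrite Ez mul0r subr0 => Eb.
  have le0 : E b * expR (- C * b) <= 0.
    rewrite Eb mulr_le0_ge0 ?subr_ge0 // mulr_le0_ge0 ?expR_ge0 //.
    have := HC c cab; rewrite ler_norml => /andP[_]; lra.
  apply/eqP; rewrite eq_le E0 andbT.
  by rewrite -(pmulr_lle0 _ (expR_gt0 (- C * b))).
- have [c cab] := MVT_everywhere ab (dg C).
  rewrite Ez mul0r sub0r => Ea.
  have le0 : 0 <= - (E a * expR (C * a)).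
    rewrite Ea mulr_ge0 ?subr_ge0 // mulr_ge0 ?expR_ge0 //.
    have := HC c cab; rewrite ler_norml => /andP[+ _]; lra.
  apply/eqP; rewrite eq_le E0 andbT.
  by rewrite -(pmulr_lle0 _ (expR_gt0 (C * a))) -oppr_ge0.
Qed.

Lemma continuous_entries_bounded m n (F : R -> 'M[R]_(m, n)) a b :
  continuous_entries F ->
  exists2 B : R, 0 <= B & forall t i j, a <= t <= b -> `|F t i j| <= B.
Proof.
move=> cF; have [ab|ba] := leP a b; last first.
  exists 0 => // t i j /andP[a1 b1].
  by move: (le_trans a1 b1); rewrite leNgt ba.
have bd (ij : 'I_m * 'I_n) : exists B : R,
    forall t, a <= t <= b -> `|F t ij.1 ij.2| <= B.
  have cn : {within `[a, b], continuous (fun t => `|F t ij.1 ij.2|)}.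
    apply: continuous_subspaceT => t; apply: continuous_comp.
      exact: cF.
    exact: norm_continuous.
  have [c _ Hc] := EVT_max ab cn.
  by exists `|F c ij.1 ij.2| => t tab; apply: Hc; rewrite in_itv.
have [B HB] := fin_all_exists bd.
exists (\sum_ij `|B ij|); first exact: sumr_ge0.
move=> t i j tab; apply: le_trans (HB (i, j) t tab) _.
rewrite (bigD1 (i, j)) //=; apply: le_trans (ler_norm _) _.
by rewrite lerDl; exact: sumr_ge0.
Qed.

Lemma continuous_mulf (g h : R -> R) :
  continuous g -> continuous h -> continuous (fun t => g t * h t).
Proof. by move=> cg ch t; apply: continuousM; [exact: cg|exact: ch]. Qed.

Lemma continuous_invf (g : R -> R) : (forall t, g t != 0) ->
  continuous g -> continuous (fun t => (g t)^-1).
Proof. by move=> g0 cg t; apply: continuousV; [exact: g0|exact: cg]. Qed.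

Lemma continuous_cstf (c : R) : continuous (fun _ : R => c).
Proof. by move=> t; exact: cst_continuous. Qed.

Lemma continuous_sumf I (r : seq I) (h : I -> R -> R) :
  (forall i, continuous (h i)) -> continuous (fun t => \sum_(i <- r) h i t).
Proof.
move=> ch; elim: r => [|i r IH].
  rewrite (_ : (fun _ => _) = fun=> 0); first exact: cst_continuous.
  by apply/funext => t; rewrite big_nil.
rewrite (_ : (fun _ => _) = fun t => h i t + \sum_(i <- r) h i t).
  by move=> t; apply: continuousD; [exact: ch|exact: IH].
by apply/funext => t; rewrite big_cons.
Qed.

Lemma continuous_prodf I (r : seq I) (h : I -> R -> R) :
  (forall i, continuous (h i)) -> continuous (fun t => \prod_(i <- r) h i t).
Proof.
move=> ch; elim: r => [|i r IH].
  rewrite (_ : (fun _ => _) = fun=> 1); first exact: cst_continuous.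
  by apply/funext => t; rewrite big_nil.
rewrite (_ : (fun _ => _) = fun t => h i t * \prod_(i <- r) h i t).
  by move=> t; apply: continuousM; [exact: ch|exact: IH].
by apply/funext => t; rewrite big_cons.
Qed.

Lemma continuous_det n (F : R -> 'M[R]_n) :
  continuous_entries F -> continuous (fun t => \det (F t)).
Proof.
move=> cF.
have -> : (fun t => \det (F t)) = (fun t => \sum_(s : 'S_n)
    ((-1) ^+ odd_perm s : R) * \prod_i F t i (s i)).
  by [].
apply: continuous_sumf => s; apply: continuous_mulf; first exact: continuous_cstf.
by apply: continuous_prodf => i; exact: cF.
Qed.

Lemma continuous_invmx n (F : R -> 'M[R]_n) :
  continuous_entries F -> (forall t, F t \in unitmx) ->
  continuous_entries (fun t => invmx (F t)).
Proof.
move=> cF uF i j.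
rewrite (_ : (fun _ => _) = fun t => (\det (F t))^-1 *
    ((-1) ^+ (j + i) * \det (row' j (col' i (F t))))); last first.
  by apply/funext => t; rewrite /invmx uF !mxE.
apply: continuous_mulf.
  apply: continuous_invf; last exact: continuous_det.
  by move=> t; have := uF t; rewrite unitmxE unitfE.
apply: continuous_mulf; first exact: continuous_cstf.
apply: continuous_det => k l.
rewrite (_ : (fun _ => _) = fun t => F t (lift j k) (lift i l)); first exact: cF.
by apply/funext => s; rewrite !mxE.
Qed.

Lemma continuous_mulmx m n q (F : R -> 'M[R]_(m, n)) (G : R -> 'M[R]_(n, q)) :
  continuous_entries F -> continuous_entries G ->
  continuous_entries (fun t => F t *m G t).
Proof.
move=> cF cG i j.
rewrite (_ : (fun _ => _) = fun t => \sum_k F t i k * G t k j).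
  by apply: continuous_sumf => k; apply: continuous_mulf; [exact: cF|exact: cG].
by apply/funext => t; rewrite mxE.
Qed.

End Calculus.

(** * Linear systems and variation of constants *)

Section Primitive.
Context {R : realType}.
Implicit Types (g : R -> R) (a b t : R).
Local Notation mu := (@lebesgue_measure R).

Lemma continuous_integrable g a b :
  continuous g -> mu.-integrable `[a, b] (EFin \o g).
Proof.
move=> cg; apply: continuous_compact_integrable; first exact: segment_compact.
exact: continuous_subspaceT.
Qed.

Lemma Rintegral_split g a b t : continuous g -> a <= b -> b <= t ->
  \int[mu]_(s in `[a, t]) g s =
  \int[mu]_(s in `[a, b]) g s + \int[mu]_(s in `[b, t]) g s.
Proof.
move=> cg ab bt.
have := @Rintegral_itvB _ g (BLeft a) (BRight t) b (continuous_integrable a t cg).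
rewrite !bnd_simp => /(_ ab bt); rewrite Rintegral_itv_obnd_cbnd; last first.
  apply: integrableS (continuous_integrable b t cg) => //.
  by move=> s /=; rewrite !in_itv /= => /andP[/ltW -> ->].
by move=> <-; rewrite addrC subrK.
Qed.

(** An antiderivative on the whole line.  Lebesgue integrals run over sets, not
    oriented intervals, so the base point is moved to the left of both 0 and
    [t]; subtracting the integral up to 0 makes the value independent of that
    base point (see [primitiveE]). *)
Definition primitive g t : R :=
  \int[mu]_(s in `[- (`|t| + 1), t]) g s - \int[mu]_(s in `[- (`|t| + 1), 0]) g s.

Lemma primitiveE g a t : continuous g -> a <= - (`|t| + 1) ->
  primitive g t = \int[mu]_(s in `[a, t]) g s - \int[mu]_(s in `[a, 0]) g s.
Proof.
move=> cg ale; rewrite /primitive.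
rewrite (Rintegral_split cg ale); last first.
  have : - `|t| <= t by rewrite lerNl -normrN ler_norm.
  lra.
rewrite [X in _ = _ - X](Rintegral_split cg ale); last by have := normr_ge0 t; lra.
by ring.
Qed.

Lemma is_derive_primitive g t : continuous g ->
  is_derive t (1 : R) (primitive g) (g t).
Proof.
move=> cg; pose a : R := - (`|t| + 2).
have ta : a < t.
  have : - `|t| <= t by rewrite lerNl -normrN ler_norm.
  by rewrite /a; lra.
have t1 : t < t + 1 by rewrite ltrDl ltr01.
have [dF FE] := @continuous_FTC1_closed _ g a t (t + 1)
  t1 (continuous_integrable a (t + 1) cg) ta (cg t).
pose c := \int[mu]_(s in `[a, 0]) g s.
apply: (@near_eq_is_derive _ _ _
  (fun t => \int[mu]_(s in `[a, t]) g s - c) (primitive g)).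
  near=> s; rewrite (@primitiveE g a) // /a lerN2.
  have : `|t - s| < 1 by near: s; apply: (@nbhsx_ballx _ _ t 1).
  have := ler_normB t (t - s); rewrite opprB addrCA subrr addr0.
  lra.
have H1 : is_derive t (1 : R) (fun t => \int[mu]_(s in `[a, t]) g s) (g t).
  by apply: DeriveDef => //; rewrite -derive1E.
have := is_deriveB H1 (is_derive_cst c t (1 : R)) => H.
by apply: (is_derive_eq H); rewrite subr0.
Unshelve. all: by end_near. Qed.

Lemma primitive0 g : primitive g 0 = 0.
Proof. by rewrite /primitive subrr. Qed.

Lemma primitive_Rintegral g t : continuous g -> 0 <= t ->
  primitive g t = \int[mu]_(s in `[0, t]) g s.
Proof.
move=> cg t0; rewrite /primitive.
rewrite (@Rintegral_split g _ 0) //; ring.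
Qed.

End Primitive.

Section LinearSystem.
Context {R : realType} {n : nat}.
Implicit Types (A X : R -> 'M[R]_n) (f x y : R -> 'cV[R]_n) (c : 'cV[R]_n).

Lemma solutionB A f x y : solution A f x -> solution A f y ->
  homogeneous_solution A (fun t => x t - y t).
Proof.
move=> Hx Hy t; have := is_deriveB (Hx t) (Hy t) => H.
by apply: (is_derive_eq H); rewrite addr0 mulmxBr opprD addrACA subrr addr0.
Qed.

Lemma solutionD A f x y : solution A f x -> homogeneous_solution A y ->
  solution A f (fun t => x t + y t).
Proof.
move=> Hx Hy t; have := is_deriveD (Hx t) (Hy t) => H.
by apply: (is_derive_eq H); rewrite addr0 mulmxDr addrAC.
Qed.

(** Energy estimate: [E = |x|^2] satisfies [|E'| <= C E] on every bounded
    interval, since the entries of [A] are bounded there. *)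
Lemma homogeneous_solution_vanish A x (t0 : R) : continuous_entries A ->
  homogeneous_solution A x -> x t0 = 0 -> forall t, x t = 0.
Proof.
move=> cA Hx x0 t.
pose E s := \sum_i x s i 0 * x s i 0.
pose dE s := \sum_i (2 * x s i 0 * \sum_j A s i j * x s j 0).
have HE s : is_derive s (1 : R) E (dE s).
  apply: is_derive_sumf => i.
  have /is_derive_mxP/(_ i 0) Hi := Hx s.
  have := is_deriveM Hi Hi => H; apply: (is_derive_eq H).
  by rewrite addr0 mxE /GRing.scale /=; ring.
have E0 s : 0 <= E s by apply: sumr_ge0 => i _; exact: sqr_ge0.
have Ez s : (E s = 0) <-> (x s = 0).
  split=> [/eqP|xs]; last by rewrite /E xs big1 // => i _; rewrite mxE mul0r.
  rewrite psumr_eq0 => [/allP H|i _]; last exact: sqr_ge0.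
  apply/colP => i; rewrite mxE; apply/eqP.
  by have := H i (mem_index_enum _); rewrite mulf_eq0 orbb.
have bd a b : exists C, forall s, a <= s <= b -> `|dE s| <= C * E s.
  have [B B0 HB] := continuous_entries_bounded a b cA.
  (* From [2 |u v| <= u^2 + v^2]: each square then occurs [n] times in each of
     two double sums. *)
  exists (B *+ n *+ 2) => s sab.
  apply: le_trans (ler_norm_sum _ _ _) _.
  apply: (@le_trans _ _ (\sum_i \sum_(j < n)
      B * (x s i 0 * x s i 0 + x s j 0 * x s j 0))).
    apply: ler_sum => i _; rewrite mulr_sumr.
    apply: le_trans (ler_norm_sum _ _ _) _; apply: ler_sum => j _.
    have -> : 2 * x s i 0 * (A s i j * x s j 0) =
      A s i j * (2 * (x s i 0 * x s j 0)) by ring.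
    rewrite normrM; apply: ler_pM => //; first exact: HB.
    have := sqr_ge0 (x s i 0 - x s j 0); have := sqr_ge0 (x s i 0 + x s j 0).
    by rewrite ler_norml !expr2 => ? ?; apply/andP; split; lra.
  rewrite le_eqVlt; apply/orP; left; apply/eqP.
  under eq_bigr do rewrite -mulr_sumr big_split /= sumr_const card_ord.
  rewrite -mulr_sumr big_split /= -/(E s) sumr_const card_ord sumrMnl.
  by rewrite -/(E s) mulrDr !mulrnAr !mulrnAl mulr2n.
apply/Ez; have /Ez Et0 := x0.
have [tt|tt] := leP t0 t.
  have [C HC] := bd t0 t.
  by case: (differential_inequality_vanish tt HE E0 HC) => H _; exact: H.
have [C HC] := bd t t0.
by case: (differential_inequality_vanish (ltW tt) HE E0 HC) => _; exact.
Qed.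

Lemma solution_unique A f x y (t0 : R) : continuous_entries A ->
  solution A f x -> solution A f y -> x t0 = y t0 -> forall t, x t = y t.
Proof.
move=> cA Hx Hy xy t; apply/eqP; rewrite -subr_eq0; apply/eqP.
apply: (homogeneous_solution_vanish (t0 := t0) cA (solutionB Hx Hy)).
by rewrite /= xy subrr.
Qed.

Lemma solution_shift A f x (p : R) : periodic A p -> periodic f p ->
  solution A f x -> solution A f (fun t => x (t + p)).
Proof.
move=> Ap fp Hx t; apply/is_derive_mxP => i j.
have /is_derive_mxP/(_ i j) Hi := Hx (t + p).
have H := @is_derive1_comp R (fun s => x s i j) (shift p) t _ _ Hi (is_derive_shift t 1 p).
by apply: (is_derive_eq H); rewrite mulr1 Ap fp.
Qed.

End LinearSystem.

Section FundamentalMatrix.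
Context {R : realType} {n : nat} {A X : R -> 'M[R]_n} {f : R -> 'cV[R]_n}.
Hypothesis A_cont : continuous_entries A.
Hypothesis X_fund : fundamental_matrix A X.
Implicit Types (x y : R -> 'cV[R]_n) (c : 'cV[R]_n).

Lemma fundamental_solution c : homogeneous_solution A (fun t => X t *m c).
Proof.
move=> t; case: X_fund => _ HX.
have := is_derive_mulmx (HX t) (is_derive_cst c t (1 : R)) => H.
by apply: (is_derive_eq H); rewrite mulmx0 mulmxA.
Qed.

Lemma homogeneous_solutionE x : homogeneous_solution A x ->
  forall t, x t = X t *m x 0.
Proof.
move=> Hx; apply: (solution_unique (t0 := 0) A_cont Hx (fundamental_solution _)).
by case: X_fund => -> _; rewrite mul1mx.
Qed.

(** A vector killed by [X t] would start a solution vanishing at time [t], hence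
    everywhere. *)
Lemma fundamental_unit t : X t \in unitmx.
Proof.
rewrite -unitmx_tr -row_free_unit -kermx_eq0; apply: contraT => /rowV0Pn[v].
move=> /sub_kermxP vX v0; case/eqP: v0.
have Xv : X t *m v^T = 0 by rewrite -[X t]trmxK -trmx_mul vX trmx0.
have := homogeneous_solution_vanish A_cont (fundamental_solution v^T) Xv 0.
by case: X_fund => -> _; rewrite mul1mx => /(congr1 trmx); rewrite trmxK trmx0.
Qed.

Lemma fundamental_continuous : continuous_entries X.
Proof.
move=> i j t; apply/differentiable_continuous; rewrite -derivable1_diffP.
by case: X_fund => _ /(_ t)/is_derive_mxP/(_ i j)[].
Qed.

Hypothesis f_cont : continuous_entries f.

Let forcing t : 'cV[R]_n := invmx (X t) *m f t.

Lemma forcing_continuous : continuous_entries forcing.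
Proof.
apply: continuous_mulmx f_cont; apply: continuous_invmx fundamental_unit.
exact: fundamental_continuous.
Qed.

Let G t : 'cV[R]_n := \col_i primitive (fun s => forcing s i 0) t.

Lemma variation_of_constants c : solution A f (fun t => X t *m (c + G t)).
Proof.
move=> t; case: X_fund => _ HX.
have HG : is_derive t (1 : R) (fun s => c + G s) (0 + forcing t).
  apply: is_deriveD; apply/is_derive_mxP => i j.
  rewrite (_ : (fun _ => _) = primitive (fun s => forcing s i 0)).
    by rewrite ord1; apply: is_derive_primitive; exact: forcing_continuous.
  by apply/funext => s; rewrite mxE.
have := is_derive_mulmx (HX t) HG => H; apply: (is_derive_eq H).
by rewrite add0r mulmxA /forcing mulKVmx ?mulmxA ?fundamental_unit.
Qed.

Lemma solution_exists c : exists2 x, solution A f x & x 0 = c.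
Proof.
exists (fun t => X t *m (c + G t)); first exact: variation_of_constants.
case: X_fund => -> _; rewrite mul1mx -[RHS]addr0; congr (_ + _).
by apply/colP => i; rewrite !mxE primitive0.
Qed.

Lemma solution_after_period x (p : R) : 0 <= p -> solution A f x ->
  x p = X p *m x 0 + b_vector X f p.
Proof.
move=> p0 Hx.
rewrite (solution_unique (t0 := 0) A_cont Hx (variation_of_constants (x 0))).
  rewrite mulmxDr; congr (_ + _ *m _); apply/colP => i; rewrite !mxE.
  rewrite primitive_Rintegral //; exact: forcing_continuous.
case: X_fund => -> _; rewrite mul1mx -[LHS]addr0; congr (_ + _).
by apply/colP => i; rewrite !mxE primitive0.
Qed.

End FundamentalMatrix.

(** * Floquet theory of periodic systems *)

Section MatrixNorm.
Context {R : realType} {m n : nat}.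
Implicit Types (N : 'M[R]_(m, n)) (K : R).

Lemma mx_norm_le N K : 0 <= K -> (forall i j, `|N i j| <= K) -> `|N| <= K.
Proof.
by move=> K0 NK; rewrite [`|N|]mx_normrE; apply: bigmax_le.
Qed.

Lemma le_mx_norm N i j : `|N i j| <= `|N|.
Proof. by rewrite [`|N|]mx_normrE; exact: (le_bigmax _ _ (i, j)). Qed.

End MatrixNorm.

(** Fredholm alternative: the range of [N] is cut out by the row vectors [u] with
    [u N = 0]. *)
Lemma left_null_witness (F : fieldType) n (N : 'M[F]_n) (b : 'cV[F]_n) :
  ~ (exists c : 'cV[F]_n, b = N *m c) ->
  exists u : 'rV[F]_n, u *m N = 0 /\ (u *m b) 0 0 != 0.
Proof.
move=> bN; have : ~~ (b^T <= N^T)%MS.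
  apply/negP => /submxP[D bD]; apply: bN; exists D^T.
  by rewrite -[b]trmxK bD trmx_mul trmxK.
rewrite submxE => H.
have [j Hj] : exists j, (b^T *m cokermx N^T) 0 j != 0.
  apply/existsP; apply: contraT; rewrite negb_exists => /forallP H0.
  case/eqP: H; apply/rowP => j; rewrite [RHS]mxE.
  by move: (H0 j); rewrite negbK => /eqP.
exists (col j (cokermx N^T))^T; rewrite colE; split.
  by rewrite -[N]trmxK -trmx_mul mulmxA trmxK mulmx_coker mul0mx trmx0.
rewrite -[b]trmxK -trmx_mul mulmxA -colE mxE.
by rewrite [X in X != _]mxE.
Qed.

Lemma linear_growth_unbounded {R : realType} (a b K : R) :
  b != 0 -> ~ forall k : nat, `|a + b *+ k| <= K.
Proof.
move=> b0 H.
have K0 : 0 <= K by apply: le_trans (H 0%N).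
have bn : 0 < `|b| by rewrite normr_gt0.
have d0 : 0 <= (K + `|a|) / `|b| by rewrite divr_ge0 // addr_ge0.
have := archi_boundP d0; set k := Num.bound _.
rewrite ltr_pdivrMr // mulrC mulr_natr -normrMn ltNge => /negP; apply.
have := ler_normB (a + b *+ k) a; rewrite [a + _]addrC addrK.
by move/le_trans; apply; rewrite lerD2r addrC.
Qed.

Section Floquet.
Context {R : realType} {n : nat} {p : R} {A X : R -> 'M[R]_n}
  {f : R -> 'cV[R]_n}.
Hypothesis p_gt0 : 0 < p.
Hypothesis A_cont : continuous_entries A.
Hypothesis A_per : periodic A p.
Hypothesis X_fund : fundamental_matrix A X.
Implicit Types (x y : R -> 'cV[R]_n) (c : 'cV[R]_n).

Let M := X p.
Let periods t : nat := Num.truncn (t / p).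

(** Both sides, applied to a vector, solve the same initial value problem since
    [A] is periodic. *)
Lemma fundamental_shift t : X (t + p) = X t *m M.
Proof.
have zero_per : periodic (fun=> 0 : 'cV[R]_n) p by [].
suff H c : X (t + p) *m c = X t *m (M *m c).
  by apply/matrixP => i j; have := H (delta_mx j 0);
     rewrite mulmxA -!colE => /colP/(_ i); rewrite !mxE.
have Hc := fundamental_solution X_fund c.
rewrite (homogeneous_solutionE A_cont X_fund
  (solution_shift A_per zero_per Hc)).
by rewrite add0r.
Qed.

Lemma fundamental_shiftn t k : X (t + p *+ k) = X t *m M ^+ k.
Proof.
elim: k => [|k IH]; first by rewrite mulr0n addr0 expr0 mulmx1.
by rewrite mulrSr addrA fundamental_shift IH exprSr mulmxA.
Qed.

Lemma fundamental_periods k : X (p *+ k) = M ^+ k.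
Proof.
by rewrite -[p *+ k]add0r fundamental_shiftn; case: X_fund => -> _; rewrite mul1mx.
Qed.

(** Writing [t = s + k p] with [s] in [0, p], we have [X t c = X s (M^k c)], and
    [X] is bounded on the compact interval.  This turns every bound on orbits of
    the monodromy matrix into a bound in continuous time. *)
Lemma flow_norm_le :
  exists2 B : R, 0 <= B & forall t c (K : R), 0 <= t -> 0 <= K ->
    (forall j, `|(M ^+ periods t *m c) j 0| <= K) -> `|X t *m c| <= B * K.
Proof.
have [B B0 HB] := continuous_entries_bounded 0 p
  (fundamental_continuous X_fund).
exists (B *+ n); first exact: mulrn_wge0.
move=> t c K t0 K0 Hc; set k := periods t in Hc.
have tp0 : 0 <= t / p by rewrite divr_ge0 // ltW.
have /andP[kt tk] := truncn_itv tp0; rewrite -/(periods t) -/k in kt tk.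
rewrite ler_pdivlMr // mulr_natl in kt; rewrite ltr_pdivrMr // mulr_natl in tk.
pose s := t - p *+ k.
have sp : 0 <= s <= p by rewrite subr_ge0 kt lerBlDr -mulrS ltW.
rewrite -[t](subrK (p *+ k)) -/s fundamental_shiftn -mulmxA.
apply: mx_norm_le => [|i j]; first by rewrite mulr_ge0 ?mulrn_wge0.
rewrite ord1 mxE; apply: le_trans (ler_norm_sum _ _ _) _.
apply: (@le_trans _ _ (\sum_(j0 < n) B * K)).
  by apply: ler_sum => l _; rewrite normrM ler_pM // HB.
by rewrite sumr_const card_ord mulrnAl.
Qed.

Lemma flow_bounded c (K : R) : (forall k i, `|(M ^+ k *m c) i 0| <= K) ->
  bounded_sol (fun t => X t *m c).
Proof.
move=> HK; have [B B0 HB] := flow_norm_le.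
exists (B * `|K|) => t t0; apply: HB => // j.
exact: le_trans (HK _ j) (ler_norm K).
Qed.

Lemma bounded_flow_orbit c : bounded_sol (fun t => X t *m c) ->
  exists K : R, forall k i, `|(M ^+ k *m c) i 0| <= K.
Proof.
move=> [K HK]; exists K => k i; apply: le_trans (le_mx_norm _ i 0) _.
by rewrite -fundamental_periods; apply: HK; rewrite mulrn_wge0 // ltW.
Qed.

Lemma flow_decay c (K r : R) : 0 <= K -> 0 <= r < 1 ->
  (forall k i, `|(M ^+ k *m c) i 0| <= K * r ^+ k) ->
  `|X t *m c| @[t --> +oo] --> (0 : R).
Proof.
move=> K0 /andP[r0 r1] Hc; have [B B0 HB] := flow_norm_le.
have cv : (fun k => B * K * r ^+ k) @ \oo --> (0 : R).
  rewrite -[X in _ --> X](mulr0 (B * K)); apply: cvgMr.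
  by apply: cvg_expr; rewrite ger0_norm.
apply/cvgrPdist_le => e e0.
move/cvgrPdist_le : cv => /(_ e e0)[N _ HN].
near=> t.
have t0 : 0 <= t by near: t; apply: nbhs_pinfty_ge; rewrite num_real.
have tN : N%:R * p <= t by near: t; apply: nbhs_pinfty_ge; rewrite num_real.
rewrite sub0r normrN normr_id.
apply: (@le_trans _ _ (B * (K * r ^+ periods t))).
  by apply: HB => //; rewrite mulr_ge0 ?exprn_ge0.
have := HN (periods t); rewrite /= sub0r normrN -mulrA.
move=> /(_ _)/(le_trans (ler_norm _)); apply.
by rewrite /periods truncn_ge_nat ?ler_pdivlMr // divr_ge0 // ltW.
Unshelve. all: by end_near. Qed.

Hypothesis f_per : periodic f p.

Lemma periodic_of_first_return x :
  solution A f x -> x p = x 0 -> periodic x p.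
Proof.
move=> Hx xp t.
apply: (solution_unique (t0 := 0) A_cont (solution_shift A_per f_per Hx) Hx).
by rewrite add0r.
Qed.

Hypothesis f_cont : continuous_entries f.

(** Shifting time by [k p] preserves the system, so the formula for the first
    period ([solution_after_period]) applies from every multiple of [p]. *)
Lemma solution_next_period x k : solution A f x ->
  x (p *+ k.+1) = M *m x (p *+ k) + b_vector X f p.
Proof.
move=> Hx.
have Ak : periodic A (p *+ k) by move=> t; exact: periodicn.
have fk : periodic f (p *+ k) by move=> t; exact: periodicn.
have := solution_after_period A_cont X_fund f_cont (ltW p_gt0)
  (solution_shift Ak fk Hx).
by rewrite add0r mulrS.
Qed.

(** Pairing the recursion with a left fixed vector [u] of [M] such that
    [u b != 0] gives [u x(k p) = u x(0) + k (u b)], which grows linearly. *)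
Lemma resonance_unbounded x : ~ in_range (1%:M - M) (b_vector X f p) ->
  solution A f x -> ~ bounded_sol x.
Proof.
move=> /left_null_witness[u [uM ub]] Hx [K HK].
have uE : u *m M = u.
  by apply/esym/eqP; rewrite -subr_eq0 -{1}[u]mulmx1 -mulmxBr uM.
apply: (@linear_growth_unbounded R ((u *m x 0) 0 0) _
  (\sum_j `|u 0 j| * K) ub) => k.
have -> : (u *m x 0) 0 0 + (u *m b_vector X f p) 0 0 *+ k =
    (u *m x (p *+ k)) 0 0.
  elim: k => [|k IH]; first by rewrite !mulr0n addr0.
  rewrite (solution_next_period k Hx) mulmxDr [u *m (M *m _)]mulmxA uE mulrSr addrA IH.
  by rewrite [RHS]mxE.
rewrite mxE; apply: le_trans (ler_norm_sum _ _ _) _.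
apply: ler_sum => j _; rewrite normrM ler_wpM2l //.
apply: le_trans (le_mx_norm _ j 0) _; apply: HK.
by rewrite mulrn_wge0 // ltW.
Qed.

Lemma periodic_solution_exists : in_range (1%:M - M) (b_vector X f p) ->
  exists2 y, solution A f y & periodic y p.
Proof.
move=> [c bE]; have [y Hy y0] := solution_exists A_cont X_fund f_cont c.
exists y => //; apply: (periodic_of_first_return Hy).
rewrite (solution_after_period A_cont X_fund f_cont (ltW p_gt0) Hy) y0 bE.
by rewrite mulmxBl mul1mx addrC subrK.
Qed.

Lemma solution_flowE x y t : solution A f x -> solution A f y ->
  x t = y t + X t *m (x 0 - y 0).
Proof.
move=> Hx Hy.
by rewrite -(homogeneous_solutionE A_cont X_fund (solutionB Hx Hy)) addrC subrK.
Qed.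

End Floquet.

Lemma periodic_bounded_sol {R : realType} {n : nat} (y : R -> 'cV[R]_n) (p : R) :
  0 < p -> continuous_entries y -> periodic y p -> bounded_sol y.
Proof.
move=> p0 cy yp; have [B B0 HB] := continuous_entries_bounded 0 p cy.
exists B => t t0.
have tp0 : 0 <= t / p by rewrite divr_ge0 // ltW.
have /andP[] := truncn_itv tp0; set k := Num.truncn _ => kt tk.
rewrite ler_pdivlMr // mulr_natl in kt; rewrite ltr_pdivrMr // mulr_natl in tk.
rewrite -[t](subrK (p *+ k)) periodicn //.
apply: mx_norm_le => // i j; apply: HB.
by rewrite subr_ge0 kt lerBlDr -mulrS ltW.
Qed.

Lemma solution_continuous {R : realType} {n : nat} (A : R -> 'M[R]_n)
  (f x : R -> 'cV[R]_n) : solution A f x -> continuous_entries x.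
Proof.
move=> Hx i j t; apply/differentiable_continuous; rewrite -derivable1_diffP.
by move: (Hx t) => /is_derive_mxP/(_ i j)[].
Qed.

Section Superposition.
Context {R : realType} {n : nat}.
Implicit Types (x y : R -> 'cV[R]_n).

Lemma bounded_solD x y :
  bounded_sol x -> bounded_sol y -> bounded_sol (fun t => x t + y t).
Proof.
move=> [K HK] [L HL]; exists (K + L) => t t0.
by apply: le_trans (ler_normD _ _) _; apply: lerD; [exact: HK|exact: HL].
Qed.

Lemma bounded_solN x : bounded_sol x -> bounded_sol (fun t => - x t).
Proof. by move=> [K HK]; exists K => t t0; rewrite normrN; exact: HK. Qed.

End Superposition.

Lemma infinite_periodic_solutions {R : realType} {n : nat} (p : R)
    (A X : R -> 'M[R]_n) (f y : R -> 'cV[R]_n) (v : 'cV[R]_n) :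
  continuous_entries A -> periodic A p -> fundamental_matrix A X ->
  v != 0 -> X p *m v = v -> solution A f y -> periodic y p ->
  infinite_set [set x | solution A f x /\ periodic x p].
Proof.
move=> A_cont A_per X_fund v0 Xv Hy yp.
pose g (k : nat) := fun t => y t + X t *m (k%:R *: v).
move=> fin; apply: infinite_nat.
rewrite (_ : [set: nat] = g @^-1` [set x | solution A f x /\ periodic x p]).
  apply: finite_preimage fin => k l _ _ /(congr1 (@^~ 0)).
  rewrite /g; case: X_fund => -> _; rewrite !mul1mx => /addrI/eqP.
  rewrite -subr_eq0 -scalerBl scaler_eq0 (negPf v0) orbF subr_eq0 eqr_nat.
  by move/eqP.
apply/esym/seteqP; split=> // k _; split.
  exact: solutionD Hy (fundamental_solution X_fund _).
move=> t; rewrite /g yp (fundamental_shift A_cont A_per X_fund) -mulmxA.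
by rewrite -scalemxAr Xv.
Qed.

(** * The dichotomy for periodic forcing *)

Unset Implicit Arguments.
Set Strict Implicit.

Theorem theorem2p1 (R : realType) (n : nat) (p : R)
    (A X : R -> 'M[R]_n) (f : R -> 'cV[R]_n)
    (p_gt0 : 0 < p)
    (A_cont : continuous_entries A) (f_cont : continuous_entries f)
    (A_per : periodic A p) (f_per : periodic f p)
    (X_fund : fundamental_matrix A X)
    (hom_per : exists x : R -> 'cV[R]_n,
       [/\ homogeneous_solution A x, periodic x p & exists t, x t != 0]) :
  let b := b_vector X f p in
  [/\ (* parenthetical remark in the assumption *)
      1%:M - X p \notin unitmx,
      (* Case 1 *)
      ~ in_range (1%:M - X p) b ->
        forall x, solution A f x -> ~ bounded_sol x
    & (* Case 2 *)
      in_range (1%:M - X p) b ->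
      [/\ infinite_set [set x | solution A f x /\ periodic x p],
          (* (i) *)
          1 < spectral_radius (X p) ->
            exists2 x, solution A f x & ~ bounded_sol x,
          (* (ii) *)
          spectral_radius (X p) = 1 ->
          is_eigenvalue (X p) 1 ->
          (forall l : R[i], is_eigenvalue (X p) l -> `|l| = 1 -> l = 1) ->
          diagonal_jordan_blocks (X p) 1 ->
            forall x, solution A f x ->
            exists y, [/\ solution A f y, periodic y p & approaches x y]
        & (* (iii) *)
          spectral_radius (X p) = 1 ->
          (exists l : R[i], [/\ is_eigenvalue (X p) l, `|l| = 1 & l != 1]) ->
          (forall l : R[i], is_eigenvalue (X p) l -> `|l| = 1 ->
             diagonal_jordan_blocks (X p) l) ->
            forall x, solution A f x -> bounded_sol x]].
Proof.
move=> b.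
have [xh [Hxh xhp [t1 xh1]]] := hom_per.
pose v := xh 0.
have Xv : X p *m v = v.
  by rewrite -(homogeneous_solutionE A_cont X_fund Hxh) -[p]add0r xhp.
have v0 : v != 0.
  apply: contra xh1 => /eqP v0.
  by rewrite (homogeneous_solutionE A_cont X_fund Hxh) -/v v0 mulmx0.
split.
- apply/negP => u; case/eqP: v0.
  by rewrite -[v](mulKmx u) mulmxBl mul1mx Xv subrr mulmx0.
- move=> bN x.
  exact: (resonance_unbounded p_gt0 A_cont A_per X_fund f_per f_cont bN).
move=> bR.
have [y Hy yp] :=
  periodic_solution_exists p_gt0 A_cont A_per X_fund f_per f_cont bR.
have yb := periodic_bounded_sol p_gt0 (solution_continuous Hy) yp.
split.
- exact: (infinite_periodic_solutions A_cont A_per X_fund v0 Xv Hy yp).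
- move=> rho1; apply: contrapT => Hb.
  move: rho1; apply/negP; rewrite -leNgt; apply: spectral_radius_le1 => c.
  apply: (bounded_flow_orbit p_gt0 A_cont A_per X_fund).
  have Hx := solutionD Hy (fundamental_solution X_fund c).
  have xb : bounded_sol (fun t => y t + X t *m c).
    by apply: contrapT => xb; apply: Hb; exists (fun t => y t + X t *m c).
  have := bounded_solD xb (bounded_solN yb).
  rewrite (_ : (fun t => _) = (fun t => X t *m c)) //.
  by apply/funext => t; rewrite addrC addKr.
- move=> rho1 _ only1 dj x Hx.
  have rho1' : spectral_radius (X p) <= 1 by rewrite rho1.
  have [d [Xd [K [r [K0 r01 Kr]]]]] :=
    orbits_converge rho1' only1 dj (x 0 - y 0).
  exists (fun t => y t + X t *m d); split.
  + exact: solutionD Hy (fundamental_solution X_fund d).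
  + move=> t.
    by rewrite yp (fundamental_shift A_cont A_per X_fund) -mulmxA Xd.
  rewrite /approaches.
  rewrite (_ : (fun t => _) = (fun t => `|X t *m (x 0 - y 0 - d)|)).
    exact: (flow_decay p_gt0 A_cont A_per X_fund K0 r01 Kr).
  apply/funext => t; rewrite (solution_flowE A_cont X_fund t Hx Hy).
  by rewrite opprD addrACA subrr add0r -mulmxBr.
- move=> rho1 _ dj x Hx.
  have rho1' : spectral_radius (X p) <= 1 by rewrite rho1.
  have [K HK] := orbits_bounded rho1' dj (x 0 - y 0).
  have := bounded_solD yb (flow_bounded p_gt0 A_cont A_per X_fund HK).
  rewrite (_ : (fun t => _) = x) //.
  by apply/funext => t; rewrite -(solution_flowE A_cont X_fund t Hx Hy).
Qed.
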